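(* Let $(\Omega,\mathcal A,\mu,d)$ be a metric measure space equipped with a doubling Borel probability measure $\mu$. Let $\{B_i\}_{i\in\mathbb N}$ be a sequence of balls in $\Omega$ whose radii satisfy $r(B_i)\to 0$ as $i\to\infty$, and suppose that there exist constants $a,b>1$ such that $\mu(aB_i)\le b\,\mu(B_i)$ for all sufficiently large $i$. Let $E_\infty:=\limsup_{i\to\infty}B_i=\bigcap_{t=1}^\infty\bigcup_{i=t}^\infty B_i$. Then $$\mu(E_\infty)=1$$ if and only if there exists a constant $C>0$ such that for any ball $B$ centred in $\operatorname{supp}\mu$ there is a subsequence $\{L_{i,B}\}_{i\in\mathbb N}$ of $\{B_i\}_{i\in\mathbb N}$ consisting of balls contained in $B$ (i.e. $L_{i,B}\subset B$ for all $i$) such that $$\sum_{i=1}^\infty\mu(L_{i,B})=\infty$$ and, for infinitely many $Q\in\mathbb N$, $$\sum_{s,t=1}^Q\mu(L_{s,B}\cap L_{t,B})\le\frac{C}{\mu(B)}\left(\sum_{s=1}^Q\mu(L_{s,B})\right)^2 .$$ (The constant $C$ is independent of $B$.)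
   Context: $(\Omega,d)$ is a metric space, $\mathcal A$ is a $\sigma$-algebra on $\Omega$ containing all Borel sets, and $\mu$ is a probability measure on $\mathcal A$. $\operatorname{supp}\mu$ denotes the support of $\mu$, i.e. the smallest closed set of full $\mu$-measure. For $x\in\Omega$ and $r>0$, $B(x,r)=\{y\in\Omega: d(x,y)<r\}$ is the ball centred at $x$ of radius $r$; a ball $B=B(x,r)$ always comes with a prescribed centre $x$ and radius $r(B)=r$, and for $a>0$ we write $aB:=B(x,ar)$. The measure $\mu$ is doubling if there are constants $\lambda\ge1$ and $r_0>0$ such that $\mu(B(x,2r))\le\lambda\,\mu(B(x,r))$ for all $x\in\operatorname{supp}\mu$ and $0<r<r_0$. *)

(* Defs.v *)
From HB Require Import structures.
From mathcomp Require Import all_boot all_order all_algebra.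
From mathcomp Require Import all_classical all_reals all_analysis.

Set Implicit Arguments.
Unset Strict Implicit.
Unset Printing Implicit Defensive.

Import Order.TTheory GRing.Theory Num.Theory.
Import numFieldNormedType.Exports.

Local Open Scope classical_set_scope.
Local Open Scope ring_scope.
Local Open Scope ereal_scope.

(* No compatibility between the metric and the sigma-algebra is built in;
   see [borel_measurable]. *)
#[short(type="metricMeasurableType")]
HB.structure Definition MetricMeasurable (R : numDomainType)
  (d : measure_display) := { T of Metric R T & Measurable d T }.

Section metric_measure.
Context (R : realType) (d : measure_display) (T : metricMeasurableType R d).

(* The sigma-algebra may be strictly larger than the Borel one. *)
Definition borel_measurable : Prop :=
  <<s [set U : set T | open U] >> `<=` @measurable d T.

(* [S] is the smallest closed set of full measure.  This is a predicate because
   such a set need not exist on an arbitrary (non-separable) metric space. *)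
Definition is_support (mu : probability T R) (S : set T) : Prop :=
  [/\ closed S, mu S = 1 &
      forall F : set T, closed F -> mu F = 1 -> S `<=` F].

Definition doubling (mu : probability T R) (S : set T) : Prop :=
  exists lambda r0 : R, [/\ (1 <= lambda)%R, (0 < r0)%R &
    forall x rho, S x -> (0 < rho < r0)%R ->
      mu (ball x (2 * rho)%R) <= lambda%:E * mu (ball x rho)].

End metric_measure.

Arguments borel_measurable {R d} T.

(* Main.v *)
(** If the overlap condition holds in every ball [B], the Kochen-Stone
    inequality gives [mu (E `&` B) >= mu B / C], where [E] is the limsup set.
    The complement of [E] is a countable union of closed sets [K].  Covering
    [K] by the doubles of a maximal disjoint family of balls of one common
    small radius centred in [K] and in the support, doubling gives
    [mu K <= lambda * C * mu (U `&` E)], where [U] is a small neighbourhood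
    of [K]; the right-hand side tends to [0], so no density theorem is needed.

    Conversely, if [E] has full measure, the balls [B_i `<=` B] with [i >= G]
    cover almost all of [B] for every [G], and doubling together with the
    condition on [a] and [b] bounds [mu (3 B_i)] by [kappa * mu (B_i)] whenever
    [B_i] meets the support.  Vitali's covering lemma then extracts a finite
    disjoint block of such balls, of total mass at least
    [m = mu B / (2 kappa)].  Concatenate [n] successive blocks and let [S] be
    their total mass, so that [n <= S / m].  As each block is disjoint, a given
    [B_i] meets it in mass at most [mu (B_i)], so all the overlaps sum to at
    most [n * S <= S ^+ 2 / m]. *)

Require Import Defs.
From mathcomp Require Import all_boot all_order all_algebra.
From mathcomp Require Import all_classical all_reals all_analysis.
(* With [all_analysis] alone, [\bar R] has no canonical measurable structure. *)
From mathcomp Require Import measurable_realfun.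
From mathcomp Require Import ring lra.

Set Implicit Arguments.
Unset Strict Implicit.
Unset Printing Implicit Defensive.

Import Order.TTheory GRing.Theory Num.Theory.
Import numFieldNormedType.Exports.

Local Open Scope classical_set_scope.
Local Open Scope ring_scope.
Local Open Scope ereal_scope.

(** * The Kochen-Stone inequality *)

Section second_moment.
Context (d : measure_display) (T : measurableType d) (R : realType)
  (P : probability T R).
Implicit Types (F : nat -> set T) (U : set T).

(** Cauchy-Schwarz for the counting function [N] of the sets indexed by [s], which vanishes off [U]:
    the square of its integral is at most [P U] times the integral of its square. *)
Lemma second_moment F U (s : seq nat) : (forall i, measurable (F i)) ->
  measurable U -> (forall i, i \in s -> F i `<=` U) ->
  ((\sum_(i <- s) fine (P (F i))) ^+ 2 <=
   fine (P U) * \sum_(i <- s) \sum_(j <- s) fine (P (F i `&` F j)))%R.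
Proof.
move=> mF mU sFU.
set S := (\sum_(i <- s) fine (P (F i)))%R.
set D := (\sum_(i <- s) \sum_(j <- s) fine (P (F i `&` F j)))%R.
set u := fine (P U).
have PE (A : set T) : measurable A -> (fine (P A))%:E = P A.
  by move=> mA; rewrite fineK// fin_num_measure.
pose N x : R := (\sum_(i <- s) \1_(F i) x)%R.
have N0 x : (0 <= N x)%R by apply: sumr_ge0.
have mI (A : set T) : measurable A ->
    measurable_fun setT (fun x : T => (\1_A x : R)%:E).
  by move=> mA; apply/measurable_EFinP; exact: measurable_indic.
have intI (A : set T) : measurable A -> \int[P]_x (\1_A x)%:E = (fine (P A))%:E.
  by move=> mA; rewrite integral_indic// setIT PE.
have intN : \int[P]_x (N x)%:E = S%:E.
  under eq_integral do rewrite -sumEFin.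
  rewrite ge0_integral_sum//; last by move=> i; exact: mI.
  by rewrite -sumEFin; apply: eq_bigr => i _; rewrite intI.
have NN x : ((N x) ^+ 2 = \sum_(i <- s) \sum_(j <- s) \1_(F i `&` F j) x)%R.
  rewrite expr2 big_distrlr/=; apply: eq_bigr => i _; apply: eq_bigr => j _.
  by rewrite indicI.
have mN : measurable_fun setT (fun x => (N x)%:E).
  rewrite [X in measurable_fun _ X](_ : _ =
    (fun x => \sum_(i <- s) (\1_(F i) x : R)%:E)).
    by apply: emeasurable_sum => i; exact: mI.
  by apply/funext => x; rewrite sumEFin.
have mNN : measurable_fun setT (fun x => ((N x) ^+ 2)%:E).
  apply/measurable_EFinP; apply: measurable_funX.
  by apply/measurable_EFinP.
have intNN : \int[P]_x ((N x) ^+ 2)%:E = D%:E.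
  under eq_integral do rewrite NN -sumEFin.
  rewrite ge0_integral_sum//.
  - rewrite -sumEFin; apply: eq_bigr => i _.
    under eq_integral do rewrite -sumEFin.
    rewrite ge0_integral_sum//.
    + rewrite -sumEFin; apply: eq_bigr => j _.
      by rewrite intI//; exact: measurableI.
    + by move=> j; apply: mI; exact: measurableI.
  - move=> i; under eq_fun do rewrite -sumEFin.
    by apply: emeasurable_sum => j; apply: mI; exact: measurableI.
  - by move=> i x _; rewrite lee_fin sumr_ge0.
have D0 : (0 <= D)%R.
  by apply: sumr_ge0 => i _; apply: sumr_ge0 => j _; rewrite fine_ge0.
have S0 : (0 <= S)%R by apply: sumr_ge0 => i _; rewrite fine_ge0.
have u0 : (0 <= u)%R by rewrite fine_ge0.
have amgm (a b : R) : (2 * a * b <= a ^+ 2 + b ^+ 2)%R.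
  by have := sqr_ge0 (a - b)%R; rewrite sqrrB; lra.
(* integrate [2 t N <= t^2 1_U + N^2] *)
have quad (t : R) : (0 <= t)%R -> (2 * t * S <= t ^+ 2 * u + D)%R.
  move=> t0; rewrite -lee_fin EFinD EFinM (EFinM (t ^+ 2)) -intN -intNN.
  rewrite -intI// -!ge0_integralZl//; first last.
  - by rewrite lee_fin mulr_ge0.
  - by move=> x _; rewrite lee_fin.
  - by rewrite lee_fin sqr_ge0.
  - exact: mI.
  rewrite -ge0_integralD//; first last.
  - by move=> x _; rewrite lee_fin sqr_ge0.
  - by apply: emeasurable_funM => //; exact: mI.
  - by move=> x _; rewrite -EFinM lee_fin mulr_ge0 ?sqr_ge0.
  apply: ge0_le_integral => //.
  - by move=> x _; rewrite -EFinM lee_fin !mulr_ge0.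
  - exact: emeasurable_funM.
  - by apply: emeasurable_funD => //; apply: emeasurable_funM => //; exact: mI.
  move=> x _; rewrite -!EFinM -EFinD lee_fin.
  have [xU|xU] := pselect (U x).
    have -> : \1_U x = 1%R :> R by rewrite indicE mem_set.
    by rewrite mulr1; exact: amgm.
  rewrite [N x]big_seq big1 ?indicE ?memNset//= ?mulr0 ?expr0n/= ?addr0//.
  by move=> i si; rewrite indicE memNset// => /(sFU _ si).
(* If [u = 0], all these [F i] are null and [S = 0]; otherwise [t = S / u] is the optimal choice in
   [quad]. *)
have [u_gt0|] := ltP 0%R u; last first.
  move=> u_le0; have {}u_le0 : u = 0%R by apply/le_anti; rewrite u_le0 u0.
  have -> : S = 0%R; last by rewrite expr0n/= mulr_ge0.
  rewrite /S big_seq big1// => i si; apply/le_anti; rewrite fine_ge0// andbT.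
  rewrite -u_le0 fine_le ?fin_num_measure// le_measure ?inE//; exact: sFU.
have := quad (S / u)%R (divr_ge0 S0 u0).
have -> : (2 * (S / u) * S = 2 * (S ^+ 2 / u))%R by ring.
have -> : ((S / u) ^+ 2 * u = S ^+ 2 / u)%R by field; rewrite gt_eqF.
rewrite mulrDl mul1r lerD2l ler_pdivrMr// => h.
by rewrite mulrC.
Qed.

Lemma fine_sum_measure F (Q : nat) : (forall i, measurable (F i)) ->
  \sum_(0 <= i < Q) P (F i) = (\sum_(0 <= i < Q) fine (P (F i)))%:E.
Proof.
move=> mF; rewrite -sumEFin; apply: eq_bigr => i _.
by rewrite fineK// fin_num_measure.
Qed.

(** Apply [second_moment] to the indices from [m] to [Q], with a tail union as [U]. Since the total
    mass diverges, dropping the first [m] terms costs nothing in the limit, so every tail union has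
    mass at least [K^-1]; these unions decrease to the limsup. *)
Lemma kochen_stone F (K : R) : (forall i, measurable (F i)) -> (0 < K)%R ->
  \sum_(0 <= i <oo) P (F i) = +oo ->
  infinite_set [set Q : nat |
    \sum_(0 <= s < Q) \sum_(0 <= t < Q) P (F s `&` F t)
    <= K%:E * (\sum_(0 <= s < Q) P (F s)) ^+ 2] ->
  K^-1%:E <= P (lim_sup_set F).
Proof.
move=> mF K0 divF infQ.
pose S Q := (\sum_(0 <= i < Q) fine (P (F i)))%R.
have Sge (M : R) : exists N, forall Q, (N <= Q)%N -> (M <= S Q)%R.
  have : (\sum_(0 <= i < n) P (F i)) @[n --> \oo] --> +oo.
    by rewrite -divF; apply: is_cvg_nneseries.
  move/cvgeyPge => /(_ M)[N _ MN]; exists N => Q NQ.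
  by have := MN Q NQ; rewrite /= fine_sum_measure// lee_fin.
have tail m : K^-1%:E <= P (\bigcup_(k in [set k | (m <= k)%N]) F k).
  set U := \bigcup_(k in _) _.
  have mU : measurable U by apply: bigcup_measurable.
  rewrite -[P U]fineK ?fin_num_measure// lee_fin leNgt; apply/negP => uK.
  set u := fine (P U) in uK.
  have u0 : (0 <= u)%R by rewrite fine_ge0.
  have uK1 : (u * K < 1)%R by rewrite -ltr_pdivlMr// div1r.
  (* From here on [S Q * (1 - u * K) >= 2 * S m + 1], which contradicts the bound
     [(S Q - S m) ^+ 2 <= u * K * S Q ^+ 2] given by the second moment. *)
  have [N NS] := Sge ((2 * S m + 1) / (1 - u * K))%R.
  have [Q [+ NQ]] : exists Q, [set Q : nat |
      \sum_(0 <= s < Q) \sum_(0 <= t < Q) P (F s `&` F t)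
      <= K%:E * (\sum_(0 <= s < Q) P (F s)) ^+ 2] Q /\ (maxn N m <= Q)%N.
    apply: contrapT => /forallNP h; apply: infQ.
    apply: (@sub_finite_set _ _ `I_(maxn N m)); last exact: finite_II.
    by move=> Q AQ /=; rewrite ltnNge; apply/negP => NQ; exact: (h Q).
  move: NQ; rewrite geq_max => /andP[NQ mQ] /=.
  rewrite fine_sum_measure//.
  under eq_bigr => i _ do rewrite (@fine_sum_measure (fun j => F i `&` F j)
    _ (fun j => measurableI _ _ (mF i) (mF j))).
  rewrite sumEFin -!EFinM lee_fin => DK.
  have := @second_moment F U (index_iota m Q) mF mU.
  have /[swap] /[apply] :
      (forall i, i \in index_iota m Q -> F i `<=` U).
    by move=> i; rewrite mem_index_iota => /andP[mi _] x Fix; exists i.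
  have -> : (\sum_(i <- index_iota m Q) fine (P (F i)) = S Q - S m)%R.
    have -> : S Q = (S m + \sum_(i <- index_iota m Q) fine (P (F i)))%R.
      by rewrite /S (@big_cat_nat _ _ _ m 0 Q).
    by rewrite addrC addKr.
  rewrite -/u => SD.
  have DD : (\sum_(i <- index_iota m Q) \sum_(j <- index_iota m Q)
      fine (P (F i `&` F j)) <= \sum_(0 <= i < Q) \sum_(0 <= j < Q)
      fine (P (F i `&` F j)))%R.
    rewrite [leRHS](@big_cat_nat _ _ _ m 0 Q)//=.
    rewrite -[leLHS]add0r lerD//.
      by apply: sumr_ge0 => i _; apply: sumr_ge0 => j _; rewrite fine_ge0.
    apply: ler_sum => i _; rewrite [leRHS](@big_cat_nat _ _ _ m 0 Q)//=.
    rewrite -[leLHS]add0r lerD//.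
    by apply: sumr_ge0 => j _; rewrite fine_ge0.
  have {}SD : ((S Q - S m) ^+ 2 <= u * K * S Q ^+ 2)%R.
    apply: (le_trans SD); rewrite -mulrA ler_wpM2l//.
    exact: (le_trans DD).
  have Sm0 : (0 <= S m)%R by apply: sumr_ge0 => i _; rewrite fine_ge0.
  have := NS Q NQ; rewrite ler_pdivrMr ?subr_gt0// => SQ.
  have SQ0 : (0 < S Q)%R.
    rewrite ltNge; apply/negP => SQ0.
    have : (S Q * (1 - u * K) <= 0)%R.
      by rewrite mulr_le0_ge0// subr_ge0 ltW.
    by move=> /(le_trans SQ); lra.
  have : (S Q * (2 * S m + 1) <= S Q * (S Q * (1 - u * K)))%R.
    by rewrite ler_pM2l.
  have := sqr_ge0 (S m).
  move: SD; rewrite sqrrB !expr2 mulr2n; nra.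
have U_fin : P (\bigcup_(k in [set k | (0 <= k)%N]) F k) < +oo.
  apply: (le_lt_trans (probability_le1 _ _)); last exact: ltry.
  exact: bigcup_measurable.
have Ucvg := lim_sup_set_cvg P F mF U_fin.
rewrite -(cvg_lim _ Ucvg)//; apply: lime_ge; last exact: nearW.
by apply/cvg_ex; eexists; exact: Ucvg.
Qed.
End second_moment.

(** * Measures of disjoint families *)

Section disjoint_families.
Context (d : measure_display) (T : measurableType d) (R : realType)
  (P : probability T R).

Lemma measure_bigcup_seq (I : choiceType) (F : I -> set T) (s : seq I) :
  (forall i, i \in s -> measurable (F i)) -> uniq s -> trivIset [set` s] F ->
  P (\bigcup_(i in [set` s]) F i) = \sum_(i <- s) P (F i).
Proof.
by move=> mF us tF; rewrite measure_fin_bigcup// [RHS]fsbig_seq.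
Qed.

(** Since [n.+2] disjoint sets of mass above [n.+1%:R^-1] would have total mass above 1, [D] is a
    countable union of finite sets. This makes disjoint families of balls centred in the support
    countable even on a non-separable space. *)
Lemma countable_disjoint_measure_gt0 (I : choiceType) (F : I -> set T)
    (D : set I) : (forall i, D i -> measurable (F i)) -> trivIset D F ->
  (forall i, D i -> 0 < P (F i)) -> countable D.
Proof.
move=> mF tF F0.
rewrite [X in countable X](_ : _ =
    \bigcup_n [set i | D i /\ (n.+1%:R^-1 < fine (P (F i)))%R]); last first.
  apply/seteqP; split=> [i Di|i [n _ []]//].
  have : (0 < fine (P (F i)))%R.
    by rewrite fine_gt0// F0//= ltey_eq fin_num_measure//; exact: mF.
  by move=> /ltr_add_invr[n]; rewrite add0r => ?; exists n.
apply: bigcup_countable => // n _; apply: finite_set_countable.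
apply: contrapT => /(infinite_set_fset n.+2)[B BD nB].
have BD' i : i \in finmap.enum_fset B -> D i by move=> iB; have [] := BD i iB.
have mB : measurable (\bigcup_(i in [set` finmap.enum_fset B]) F i).
  by apply: fin_bigcup_measurable => // i /= iB; apply: mF; exact: BD'.
have := probability_le1 P mB; rewrite leNgt => /negP; apply.
rewrite measure_bigcup_seq ?finmap.fset_uniq//; first last.
- by apply: sub_trivIset tF => i /= /BD'.
- by move=> i /BD'; exact: mF.
apply: (@lt_le_trans _ _ (\sum_(i <- finmap.enum_fset B) n.+1%:R^-1%:E)).
  rewrite sumEFin lte_fin big_const_seq count_predT iter_addr addr0.
  rewrite -[ltRHS]mulr_natl ltr_pdivlMr// mul1r ltr_nat.
  exact: nB.
rewrite big_seq [leRHS]big_seq; apply: lee_sum => i iB.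
have [Di nF] := BD i iB.
by rewrite -[leRHS]fineK ?fin_num_measure ?lee_fin 1?ltW//; exact: mF.
Qed.

Lemma measure_setI_full (A G : set T) : measurable A -> measurable G ->
  P G = 1 -> P (A `&` G) = P A.
Proof.
move=> mA mG PG; have PGC : P (~` G) = 0 by rewrite probability_setC// PG subee.
rewrite [RHS](measureDI P mA mG) [X in _ = X + _](_ : _ = 0) ?add0e//.
apply/le_anti; rewrite measure_ge0 andbT -PGC.
apply: le_measure; rewrite ?inE; [exact: measurableD|exact: measurableC|].
by move=> x [].
Qed.

End disjoint_families.

(** * Balls centred in the support *)

Section support.
Context (R : realType) (d : measure_display) (T : metricMeasurableType R d).
Implicit Types (mu : probability T R) (S : set T).

Lemma open_mball (x : T) (rho : R) : open (ball x rho).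
Proof.
rewrite openE => y; rewrite ballEmdist/= => xy.
apply/nbhs_ballP; exists (rho - mdist x y)%R => /=; first by rewrite subr_gt0.
move=> z; rewrite !ballEmdist/= ltrBrDl => yz.
exact: le_lt_trans (metric_triangle x y z) yz.
Qed.

Lemma ball_sub_ball (x y : T) (r s : R) : (mdist x y + s <= r)%R ->
  ball y s `<=` ball x r.
Proof.
move=> xysr z; rewrite !ballEmdist/= => yz.
apply: le_lt_trans (metric_triangle x y z) _.
by apply: lt_le_trans xysr; rewrite ltrD2l.
Qed.

Hypothesis hborel : borel_measurable T.

Lemma measurable_open (U : set T) : open U -> measurable U.
Proof. by move=> oU; apply: hborel; exact: sub_sigma_algebra. Qed.

Lemma measurable_closed (K : set T) : closed K -> measurable K.
Proof.
move=> cK; rewrite -(setCK K); apply/measurableC/measurable_open.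
by rewrite openC.
Qed.

Lemma measurable_mball (x : T) (rho : R) : measurable (ball x rho).
Proof. exact/measurable_open/open_mball. Qed.

(** Otherwise the complement of [U] would be a closed set of full measure missing [x], against the
    minimality of [S]. *)
Lemma support_open_gt0 mu S (x : T) (U : set T) : is_support mu S ->
  S x -> open U -> U x -> 0 < mu U.
Proof.
move=> [_ _ Smin] Sx oU Ux; rewrite lt_neqAle measure_ge0 andbT.
apply/eqP => muU0; apply: (Smin (~` U) _ _ x Sx) => //.
  by rewrite closedC.
by rewrite probability_setC ?sube0 -?muU0 ?sube0//; exact: measurable_open.
Qed.

(** Up to the factor [lambda * M], [mu K] is bounded by the mass of [E] in the neighbourhood [U n]
    of [K]. As [K] is closed, the [U n] shrink to [K], which is disjoint from [E], so these masses
    tend to 0. *)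
Lemma closed_null mu S (E K : set T) (M : R) : is_support mu S ->
  doubling mu S -> measurable E -> closed K -> K `&` E = set0 -> (0 <= M)%R ->
  (forall x rho, S x -> (0 < rho)%R ->
    mu (ball x rho) <= M%:E * mu (E `&` ball x rho)) ->
  mu K = 0.
Proof.
move=> suppS [lambda [r0 [lambda1 r0_gt0 dbl]]] mE cK KE M0 EM.
have [cS muS1 _] := suppS.
have mK := measurable_closed cK.
pose U (n : nat) := \bigcup_(x in K) ball x n.+1%:R^-1.
have mU n : measurable (U n).
  by apply/measurable_open/bigcup_open => x _; exact: open_mball.
have capUE : \bigcap_n (U n `&` E) = set0.
  rewrite -KE; apply/seteqP; split => x.
    move=> UEx; split; last by have [] := UEx 0%N I.
    rewrite (closure_id K).1//.
    move=> V /nbhs_ballP[e /= e0 eV].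
    have [k] := ltr_add_invr e0; rewrite add0r => ke.
    have [[y Ky yx] _] := UEx k I; exists y; split => //; apply: eV.
    by apply: ball_sym; apply: le_ball yx; exact: ltW.
  by rewrite KE.
have muUE0 : (mu \o (fun n => U n `&` E)) n @[n --> \oo] --> 0.
  rewrite -(measure0 mu) -capUE; apply: nonincreasing_cvg_mu.
  - apply: (le_lt_trans (probability_le1 _ _)); last exact: ltry.
    exact: measurableI.
  - by move=> n; exact: measurableI.
  - by apply: bigcap_measurable => // n _; exact: measurableI.
  - move=> m n mn; apply/subsetPset => x [[y Ky yx] Ex]; split => //.
    exists y => //; apply: le_ball yx.
    by rewrite lef_pV2 ?posrE// ler_nat.
have key n : (n.+1%:R^-1 < r0)%R -> mu K <= (lambda * M)%:E * mu (U n `&` E).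
  set rho := (n.+1%:R^-1)%R => rho_r0.
  have rho0 : (0 < rho)%R by rewrite invr_gt0.
  (* The centres are also taken in [S], so that doubling, [EM] and positivity of the mass apply to
     each ball. *)
  have [J [JD tJ maxJ]] := ex_maximal_disjoint_subcollection
    (fun x => ball x rho) (K `&` S).
  have : countable J.
    apply: (countable_disjoint_measure_gt0 _ tJ) => x Jx.
      exact: measurable_mball.
    apply: (support_open_gt0 suppS (JD x Jx).2); first exact: open_mball.
    exact: (ball_center _ (PosNum rho0)).
  move=> /countable_injP[f finj].
  (* The ball of radius [s] about the centre numbered [k] by [f], or the empty set if there is none:
     the family becomes a sequence, ready for countable subadditivity. *)
  pose V s k := \bigcup_(x in [set x | J x /\ f x = k]) ball x s.
  have VE s x : J x -> V s (f x) = ball x s.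
    move=> Jx; apply/seteqP; split => [y [z [Jz fzx]]|y xy]; last by exists x.
    by rewrite (finj z x) ?inE.
  have V0 s k : ~ (exists2 x, J x & f x = k) -> V s k = set0.
    by move=> h; rewrite -subset0 => y [z [Jz fzk]] _; apply: h; exists z.
  have mV s k : measurable (V s k).
    by apply/measurable_open/bigcup_open => x _; exact: open_mball.
  have KV : K `&` S `<=` \bigcup_k V (2 * rho)%R k.
    (* An uncovered point is at distance at least [2 * rho] from every centre, so its own ball of
       radius [rho] could be added to the maximal family. *)
    move=> x [Kx Sx]; apply: contrapT => xV.
    have xJ y : J y -> ball x rho `&` ball y rho = set0.
      move=> Jy; rewrite -subset0 => z [xz yz]; apply: xV; exists (f y) => //.
      rewrite VE// mulr_natl mulr2n; apply: (ball_triangle yz).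
      exact: ball_sym.
    have nJx : ~ J x.
      move=> /xJ; rewrite setIid => /seteqP[+ _] => /(_ x); apply.
      exact: (ball_center _ (PosNum rho0)).
    apply: (maxJ (x |` J)).
    - rewrite properEneq; split; last by move=> y Jy; right.
      by apply/eqP => JE; apply: nJx; rewrite JE; left.
    - by move=> y [->//|/JD].
    - move=> y z [->|Jy] [->|Jz]//; last exact: tJ.
      + by rewrite xJ// => /set0P; rewrite eqxx.
      + by rewrite setIC xJ// => /set0P; rewrite eqxx.
  rewrite -(measure_setI_full mK (measurable_closed cS) muS1).
  apply: (@le_trans _ _ (\sum_(0 <= k <oo) mu (V (2 * rho)%R k))).
    by apply: measure_sigma_subadditive => //; apply: measurableI => //;
      exact: measurable_closed.
  apply: (@le_trans _ _ (\sum_(0 <= k <oo)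
      (lambda * M)%:E * mu (V rho k `&` E))).
    apply: lee_nneseries => // k _.
    have [[x Jx <-]|h] := pselect (exists2 x, J x & f x = k); last first.
      by rewrite !V0// set0I measure0 mule0.
    have Sx := (JD x Jx).2.
    rewrite !VE//; apply: (le_trans (dbl x rho Sx _)); first by rewrite rho0.
    rewrite EFinM -muleA lee_pmul2l// ?lte_fin; last exact: lt_le_trans lambda1.
    by rewrite setIC; exact: EM.
  have lM0 : (0 <= lambda * M)%R by rewrite mulr_ge0// (le_trans _ lambda1).
  rewrite nneseriesZl//; apply: lee_wpmul2l; first by rewrite lee_fin.
  rewrite [leLHS](_ : _ = mu (\bigcup_k (V rho k `&` E))); last first.
    rewrite measure_bigcup//.
    - by apply: eq_eseriesl => k; rewrite in_setT.
    - by move=> k _; exact: measurableI.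
    - move=> k l _ _ [y [[[x [Jx <-] xy] _] [[z [Jz <-] zy] _]]].
      by rewrite (tJ x z Jx Jz)//; exists y.
  apply: le_measure; rewrite ?inE.
  - by apply: bigcup_measurable => k _; exact: measurableI.
  - exact: measurableI.
  move=> y [k _ [[x [Jx _] xy] Ey]]; split => //; exists x => //.
  exact: (JD x Jx).1.
apply/le_anti; rewrite measure_ge0 andbT.
have cvg0 := @cvgeZl _ _ _ _ _ (lambda * M)%:E isT muUE0.
rewrite -[leRHS](mule0 (lambda * M)%:E) -(cvg_lim _ cvg0)//.
apply: lime_ge; first by apply/cvg_ex; eexists; exact: cvg0.
near=> n; apply: key.
near: n; exact: (near_infty_natSinv_lt (PosNum r0_gt0)).
Unshelve. all: by end_near.
Qed.

End support.

(** * Disjoint blocks of balls *)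

Section vitali.
Context (R : realType) (T : metricType R).

(** Greedy choice, largest radius first: a ball is kept unless it meets one already kept, which is
    at least as large and whose triple therefore contains it. *)
Lemma vitali_finite (c : nat -> T) (r : nat -> R) (s : seq nat) :
  (forall i, 0 < r i)%R ->
  exists D : seq nat, [/\ uniq D, {subset D <= s},
    trivIset [set` D] (fun i => ball (c i) (r i)) &
    forall i, i \in s -> exists2 j, j \in D &
      ball (c i) (r i) `<=` ball (c j) (3 * r j)%R].
Proof.
move=> r0; pose B i := ball (c i) (r i).
have B3 i j : (r i <= r j)%R -> B i `&` B j !=set0 ->
    B i `<=` ball (c j) (3 * r j)%R.
  move=> rij [z [iz jz]] y iy.
  have -> : (3 * r j = r j + (r j + r j))%R by ring.
  apply: (ball_triangle jz); apply: le_ball (lerD rij rij) _ _.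
  by apply: ball_triangle iy; exact: ball_sym.
pose le_r i j := (r i <= r j)%R.
have le_r_trans : transitive le_r by move=> x y z; exact: le_trans.
(* With the radii in increasing order, the induction settles the tail, made of the larger balls,
   before the head. *)
wlog : s / sorted le_r s.
  have /[swap]/[apply] : sorted le_r (sort le_r s).
    by apply: sort_sorted => x y; exact: le_total.
  move=> [D [uD Ds tD DB]]; exists D; split => //.
    by move=> x /Ds; rewrite mem_sort.
  by move=> i; rewrite -(mem_sort le_r); exact: DB.
elim: s => [_|i s ih]; first by exists [::]; split => // ? ?.
rewrite /= (path_sortedE le_r_trans) => /andP[/allP ris /ih[D [uD Ds tD DB]]].
have [[j jD ij]|nij] := pselect (exists2 j, j \in D & B i `&` B j !=set0).
  exists D; split => //.
    by move=> k /Ds; rewrite inE orbC => ->.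
  move=> k; rewrite inE => /predU1P[->|/DB//].
  by exists j => //; apply: B3 => //; apply: ris; exact: Ds.
have Bi0 : B i !=set0 by exists (c i); exact: (ball_center _ (PosNum (r0 i))).
exists (i :: D); split.
- rewrite /= uD andbT; apply/negP => iD; apply: nij; exists i => //.
  by rewrite setIid.
- by move=> k; rewrite !inE => /predU1P[->|/Ds ->]; rewrite ?eqxx ?orbT.
- move=> k l /=; rewrite !inE => /predU1P[->|kD] /predU1P[->|lD]//.
  + by move=> il; case: nij; exists l.
  + by rewrite setIC => ik; case: nij; exists k.
  + exact: tD.
- move=> k; rewrite inE => /predU1P[->|/DB[j jD ?]]; last first.
    by exists j => //; rewrite inE jD orbT.
  by exists i; rewrite ?inE ?eqxx//; apply: B3 => //; rewrite setIid.
Qed.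
End vitali.

Section blocks.
Context (d : measure_display) (T : measurableType d) (R : realType)
  (P : probability T R).

(** The overlap bound is obtained at the ends of blocks: for [Q = size (L n)] the first [Q] terms
    are exactly the first [n] blocks. *)
Lemma block_subsequence (F : nat -> set T) (A : set nat) (m : R) :
  (forall i, measurable (F i)) -> (0 < m)%R ->
  (forall G : nat, exists s : seq nat, [/\ sorted ltn s,
     forall i, i \in s -> (G <= i)%N /\ A i, trivIset [set` s] F &
     m%:E <= \sum_(i <- s) P (F i)]) ->
  exists phi : nat -> nat, [/\ {homo phi : i j / (i < j)%N},
    forall i, A (phi i),
    \sum_(0 <= i <oo) P (F (phi i)) = +oo &
    infinite_set [set Q : nat |
      \sum_(0 <= s < Q) \sum_(0 <= t < Q) P (F (phi s) `&` F (phi t))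
      <= m^-1%:E * (\sum_(0 <= s < Q) P (F (phi s))) ^+ 2]].
Proof.
move=> mF m0 /choice[g gP].
(* Each block is requested beyond all earlier indices, so [L n] stays strictly increasing. The
   maximum of the empty list is [0], so the first block starts at index [1] or later. *)
pose L n := iter n (fun l => l ++ g (\max_(i <- l) i).+1) [::].
have LS n : L n.+1 = L n ++ g (\max_(i <- L n) i).+1 by [].
have LA n i : i \in L n -> A i.
  elim: n i => [//|n ih] i; rewrite LS mem_cat => /orP[/ih//|].
  by have [_ gA _ _] := gP (\max_(i <- L n) i).+1; move=> /gA[].
have Lsorted n : sorted ltn (L n).
  elim: n => [//|n]; rewrite LS !(sorted_pairwise ltn_trans) pairwise_cat => ->.
  have [gs gA _ _] := gP (\max_(i <- L n) i).+1.
  rewrite -(sorted_pairwise ltn_trans) gs !andbT.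
  apply/allrelP => i j iL /gA[+ _]; apply: leq_ltn_trans.
  exact: (@leq_bigmax_seq _ (L n) xpredT id).
have Lmass n : (n%:R * m)%:E <= \sum_(i <- L n) P (F i).
  elim: n => [|n ih]; first by rewrite mul0r big_nil.
  have [_ _ _ gm] := gP (\max_(i <- L n) i).+1.
  by rewrite LS big_cat/= -natr1 mulrDl mul1r EFinD leeD.
have Lsize n : (n <= size (L n))%N.
  elim: n => [//|n ih]; rewrite LS size_cat -addn1 leq_add//.
  have [_ _ _] := gP (\max_(i <- L n) i).+1.
  by case: (g _) => [|//]; rewrite big_nil lee_fin leNgt m0.
have Lover n (X : set T) : measurable X ->
    \sum_(t <- L n) P (X `&` F t) <= n%:R%:E * P X.
  move=> mX; elim: n => [|n ih]; first by rewrite big_nil mul0e.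
  rewrite LS big_cat/= -natr1 EFinD ge0_muleDl// mul1e leeD//.
  have [gs _ gt _] := gP (\max_(i <- L n) i).+1.
  rewrite -(@measure_bigcup_seq _ _ _ P _ (fun t => X `&` F t)).
  - apply: le_measure; rewrite ?inE//.
      apply: fin_bigcup_measurable => // i _; exact: measurableI.
    by move=> x [i _ []].
  - by move=> i _; exact: measurableI.
  - by apply: sorted_uniq gs; [exact: ltn_trans|exact: ltnn].
  - by apply: trivIset_setIl.
have Lnth n k j : (k < size (L n))%N ->
    nth 0%N (L (n + j)%N) k = nth 0%N (L n) k.
  move=> kn; elim: j => [|j ih]; first by rewrite addn0.
  rewrite addnS LS nth_cat ifT//; apply: (leq_trans kn).
  elim: j {ih} => [|j]; rewrite ?addn0// addnS LS size_cat => /leq_trans ->//.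
  exact: leq_addr.
(* Blocks are non-empty because [m > 0], so [L k.+1] has an entry of rank [k] and the default [0] is
   never read; later blocks leave that entry unchanged. *)
pose phi k := nth 0%N (L k.+1) k.
have phiE n k : (k < size (L n))%N -> phi k = nth 0%N (L n) k.
  move=> kn; rewrite -(Lnth _ _ k.+1 kn) addnC Lnth//; exact: Lsize.
have sumL n (f : nat -> \bar R) :
    \sum_(0 <= i < size (L n)) f (phi i) = \sum_(i <- L n) f i.
  rewrite [RHS](big_nth 0%N); apply: eq_big_nat => i /andP[_ iL].
  by rewrite -phiE.
exists phi; split.
- move=> i j ij; rewrite (phiE j.+1 i) ?(phiE j.+1 j) ?Lsize//; last first.
    by apply: leq_trans (Lsize _); exact: ltnW.
  rewrite (sorted_ltn_nth ltn_trans)// ?inE; last exact: Lsize.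
  by apply: leq_trans (Lsize _); exact: ltnW.
- by move=> i; apply: (LA i.+1); apply: mem_nth; exact: Lsize.
- apply: eq_infty => t.
  have [n tn] : exists n : nat, (t <= n%:R * m)%R.
    exists (Num.truncn (`|t| / m)).+1; rewrite -ler_pdivrMr//.
    apply: (@le_trans _ _ (`|t| / m)%R).
      by rewrite ler_pM2r ?invr_gt0// ler_norm.
    by rewrite ltW// truncnS_gt.
  apply: (@le_trans _ _ (n%:R * m)%:E); first by rewrite lee_fin.
  apply: (le_trans (Lmass n)); rewrite -sumL.
  exact: nneseries_lim_ge.
(* If the valid [Q] formed a finite list, [n] could be taken above its maximum; but
   [size (L n) >= n] is valid too. *)
- move=> /finite_seqP[s sE].
  pose n := (\max_(i <- s) i).+1.
  suff : size (L n) \in s.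
    move=> /(@leq_bigmax_seq _ s xpredT id)/(_ isT); apply/negP.
    by rewrite -ltnNge; exact: Lsize.
  have : [set` s] (size (L n)); last by [].
  rewrite -sE /= (sumL n (fun i => P (F i))).
  rewrite (sumL n (fun i => \sum_(0 <= t < size (L n)) P (F i `&` F (phi t)))).
  under eq_bigr => i _ do rewrite (sumL n (fun t => P (F i `&` F t))).
  apply: (@le_trans _ _ (n%:R%:E * \sum_(i <- L n) P (F i))).
    rewrite ge0_sume_distrr//; apply: lee_sum => i _; exact: Lover.
  rewrite muleA; apply: lee_wpmul2r; first exact: sume_ge0.
  have := Lmass n.
  rewrite (eq_bigr (fun i => (fine (P (F i)))%:E)); last first.
    by move=> i _; rewrite fineK// fin_num_measure.
  by rewrite sumEFin -EFinM !lee_fin ler_pdivlMl// mulrC.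
Qed.
End blocks.

(** * Triple balls, and disjoint blocks inside a ball *)

Section limsup_balls.
Context (R : realType) (d : measure_display) (T : metricMeasurableType R d)
  (mu : probability T R) (S : set T) (c : nat -> T) (r : nat -> R).
Hypothesis hborel : borel_measurable T.
Hypothesis hsupp : is_support mu S.
Hypothesis hdoubling : doubling mu S.
Hypothesis hr_gt0 : forall i, (0 < r i)%R.
Hypothesis hr_cvg : r i @[i --> \oo] --> (0 : R)%R.

Local Notation B i := (ball (c i) (r i)).

Lemma radius_near (e : R) : (0 < e)%R -> \forall i \near \oo, (r i < e)%R.
Proof. by move=> e0; have /cvgr_lt := hr_cvg; exact. Qed.

(** The centre of [B i] may lie off the support, so doubling is used at a point [z] of [S] in [B i].
    The ball about [z] of radius [(a - 1) * r i] lies in the [a]-fold ball, and [k] doublings bring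
    its radius to at least [4 * r i], enough to contain the triple ball. Hence
    [kappa = lambda ^+ k * b]. *)
Lemma measure_triple_ball_le : (exists a b : R, [/\ (1 < a)%R, (1 < b)%R &
    \forall i \near \oo, mu (ball (c i) (a * r i)%R) <= b%:E * mu (B i)]) ->
  exists2 kappa : R, (0 < kappa)%R & \forall i \near \oo,
    B i `&` S !=set0 -> mu (ball (c i) (3 * r i)%R) <= kappa%:E * mu (B i).
Proof.
move=> [a [b [a1 b1 ab]]].
have [lambda [r0 [lambda1 r0_gt0 dbl]]] := hdoubling.
have lambda0 : (0 < lambda)%R by apply: lt_le_trans lambda1.
have a10 : (0 < a - 1)%R by rewrite subr_gt0.
have dbln z rho k : S z -> (0 < rho)%R -> (2 ^+ k * rho < r0)%R ->
    mu (ball z (2 ^+ k * rho)%R) <= (lambda ^+ k)%:E * mu (ball z rho).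
  move=> Sz rho0; elim: k => [|k ih] k_r0; first by rewrite !expr0 mul1r mul1e.
  have k0 : (0 < 2 ^+ k * rho)%R by rewrite mulr_gt0// exprn_gt0.
  have k_lt : (2 ^+ k * rho < r0)%R.
    by apply: le_lt_trans k_r0; rewrite exprS -mulrA; lra.
  rewrite exprS -mulrA; apply: (le_trans (dbl z _ Sz _)); first by rewrite k0.
  by rewrite exprS EFinM -muleA lee_wpmul2l ?ih// lee_fin ltW.
have [k k4] : exists k, (4 <= 2 ^+ k * (a - 1))%R.
  exists (Num.truncn (4 / (a - 1))).+1; rewrite -ler_pdivrMr//.
  apply: (@le_trans _ _ (Num.truncn (4 / (a - 1))).+1%:R).
    by rewrite ltW// truncnS_gt.
  by rewrite -natrX ler_nat ltnW// ltn_expl.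
exists (lambda ^+ k * b)%R.
  by rewrite mulr_gt0 ?exprn_gt0// (lt_trans _ b1).
(* A radius [r i] below this bound keeps all [k] doublings within the range [r0]. *)
have e0 : (0 < r0 / (2 ^+ k * (a - 1)))%R.
  by rewrite divr_gt0// mulr_gt0// exprn_gt0.
near=> i => -[z [iz Sz]].
have ri : (2 ^+ k * ((a - 1) * r i) < r0)%R.
  rewrite mulrA mulrC -ltr_pdivlMr ?mulr_gt0 ?exprn_gt0//.
  by near: i; exact: radius_near.
have ai0 : (0 < (a - 1) * r i)%R by rewrite mulr_gt0.
have {}iz : (mdist (c i) z < r i)%R by move: iz; rewrite ballEmdist.
apply: (@le_trans _ _ (mu (ball z (2 ^+ k * ((a - 1) * r i))%R))).
  apply: le_measure; rewrite ?inE; [exact: measurable_mball..|].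
  apply: ball_sub_ball; rewrite metric_sym.
  have := hr_gt0 i; nra.
apply: (le_trans (dbln z _ k Sz ai0 ri)).
rewrite EFinM -muleA; apply: lee_wpmul2l.
  by rewrite lee_fin exprn_ge0// ltW.
apply: (@le_trans _ _ (mu (ball (c i) (a * r i)%R))).
  apply: le_measure; rewrite ?inE; [exact: measurable_mball..|].
  by apply: ball_sub_ball; lra.
by near: i; exact: ab.
Unshelve. all: by end_near.
Qed.

(** Finitely many good balls carry half the mass of [ball x rho], and making them disjoint by Vitali
    costs a factor [kappa]; hence the bound with [2 * kappa]. *)
Lemma disjoint_block (kappa : R) (x : T) (rho : R) (G : nat) :
  mu (lim_sup_set (fun i => B i)) = 1 -> (0 < kappa)%R ->
  (\forall i \near \oo, B i `&` S !=set0 ->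
    mu (ball (c i) (3 * r i)%R) <= kappa%:E * mu (B i)) ->
  0 < mu (ball x rho) ->
  exists s : seq nat, [/\ sorted ltn s,
    forall i, i \in s -> (G <= i)%N /\ B i `<=` ball x rho,
    trivIset [set` s] (fun i => B i) &
    (fine (mu (ball x rho)) / (2 * kappa))%:E <= \sum_(i <- s) mu (B i)].
Proof.
move=> E1 kappa0 [N _ N3] mux0.
have mB := measurable_mball hborel.
have [cS muS1 _] := hsupp; have mS := measurable_closed hborel cS.
set E := lim_sup_set _ in E1.
have mE : measurable E.
  by apply: bigcap_measurable => // n _; apply: bigcup_measurable.
set b := fine (mu (ball x rho)).
have bE : b%:E = mu (ball x rho) by rewrite fineK// fin_num_measure.
have b0 : (0 < b)%R by rewrite -lte_fin bE.
(* Meeting [S] and [N <= i] give access to the triple-ball bound. Points of [S] cost nothing here,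
   as [S] has full measure. *)
pose good i := [/\ (G <= i)%N, (N <= i)%N, B i `<=` ball x rho &
  B i `&` S !=set0].
pose s n := [seq i <- iota 0 n | `[< good i >]].
pose W n := \bigcup_(i in [set` s n]) B i.
have mW n : measurable (W n).
  by apply: fin_bigcup_measurable => // i _; exact: mB.
have sgood n i : i \in s n -> good i by rewrite mem_filter => /andP[/asboolP].
have cover : ball x rho `&` E `&` S `<=` \bigcup_n W n.
  move=> y [[xy Ey] Sy].
  have {}xy : (mdist x y < rho)%R by move: xy; rewrite ballEmdist.
  (* A ball through [y] of radius below this lies in [ball x rho], since its points are within twice
     its radius of [y]. *)
  have e0 : (0 < (rho - mdist x y) / 2)%R by rewrite divr_gt0// subr_gt0.
  have [M _ Mr] := radius_near e0.
  have [i Mi iy] := Ey (maxn M (maxn G N)) I.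
  move: Mi; rewrite /= !geq_max => /and3P[Mi Gi Ni].
  exists i.+1 => //; exists i => //=.
  rewrite mem_filter mem_iota/= add0n ltnSn andbT; apply/asboolP; split => //.
    apply: ball_sub_ball; have /= := Mr i Mi.
    have {}iy : (mdist y (c i) < r i)%R.
      by move: iy; rewrite ballEmdist metric_sym.
    have := metric_triangle x y (c i); lra.
  by exists y.
(* Otherwise continuity from below would bound the mass of the union by [b / 2], while the union
   covers almost all of [ball x rho]. *)
have [n nW] : exists n, (b / 2)%:E <= mu (W n).
  apply: contrapT => /forallNP nW.
  have : mu (\bigcup_n W n) <= (b / 2)%:E.
    have Wcvg : (mu \o W) n @[n --> \oo] --> mu (\bigcup_n W n).
      apply: nondecreasing_cvg_mu => //; first exact: bigcup_measurable.
      move=> m n mn; apply/subsetPset => y [i /= i_s iy]; exists i => //=.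
      move: i_s; rewrite !mem_filter !mem_iota/= !add0n => /andP[-> im].
      exact: leq_trans mn.
    rewrite -(cvg_lim _ Wcvg)//; apply: lime_le.
      by apply/cvg_ex; eexists; exact: Wcvg.
    by apply: nearW => n /=; rewrite ltW// ltNge; apply/negP; exact: nW.
  apply/negP; rewrite -ltNge; apply: (@lt_le_trans _ _ b%:E).
    by rewrite lte_fin ltr_pdivrMr// ltr_pMr// ltr1n.
  rewrite bE -(measure_setI_full (mB x rho) mE E1).
  rewrite -(measure_setI_full _ mS muS1); last exact: measurableI.
  apply: le_measure; rewrite ?inE//; last exact: bigcup_measurable.
  by apply: measurableI => //; exact: measurableI.
have [D [uD Ds tD DB]] := vitali_finite c (s n) hr_gt0.
exists (sort leq D); split.
- by rewrite ltn_sorted_uniq_leq sort_uniq uD sort_sorted//; exact: leq_total.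
- by move=> i; rewrite mem_sort => /Ds/sgood[].
- by apply: sub_trivIset tD => i /=; rewrite mem_sort.
rewrite (perm_big D) ?perm_sort//=.
rewrite invfM mulrA EFinM lee_pdivrMr//.
apply: (le_trans nW).
apply: (@le_trans _ _ (\sum_(i <- D) mu (ball (c i) (3 * r i)%R))).
  rewrite [leRHS]fsbig_seq//; apply: content_sub_fsum => //.
  by move=> y [i /= /DB[j jD ij] iy]; exists j => //; exact: ij.
apply: (@le_trans _ _ (\sum_(i <- D) kappa%:E * mu (B i))).
  rewrite big_seq [leRHS]big_seq; apply: lee_sum => i /Ds/sgood[_ Ni _ BiS].
  exact: N3.
by rewrite -ge0_sume_distrr// muleC.
Qed.

End limsup_balls.

(** * The equivalence *)

Theorem theorem1 (R : realType) (d : measure_display)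
  (T : metricMeasurableType R d) (mu : probability T R)
  (suppmu : set T) (c : nat -> T) (r : nat -> R)
  (hborel : borel_measurable T)
  (hsupp : is_support mu suppmu)
  (hdoubling : doubling mu suppmu)
  (hr_gt0 : forall i, (0 < r i)%R)
  (hr_cvg : r i @[i --> \oo] --> (0 : R)%R)
  (hab : exists a b : R, [/\ (1 < a)%R, (1 < b)%R &
    \forall i \near \oo,
      mu (ball (c i) (a * r i)%R) <= b%:E * mu (ball (c i) (r i))]) :
  mu (lim_sup_set (fun i => ball (c i) (r i))) = 1
  <->
  exists2 C : R, (0 < C)%R &
    forall (x : T) (rho : R), suppmu x -> (0 < rho)%R ->
    exists phi : nat -> nat,
      let B := ball x rho in
      let L i := ball (c (phi i)) (r (phi i)) in
      [/\ {homo phi : i j / (i < j)%N},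
          forall i, L i `<=` B,
          \sum_(0 <= i <oo) mu (L i) = +oo &
          infinite_set [set Q : nat |
            \sum_(0 <= s < Q) \sum_(0 <= t < Q) mu (L s `&` L t)
            <= C%:E / mu B * (\sum_(0 <= s < Q) mu (L s)) ^+ 2]].
Proof.
have mB := measurable_mball hborel.
have mF : forall i, measurable (ball (c i) (r i)) by move=> i; exact: mB.
have mu_ball_gt0 x rho : suppmu x -> (0 < rho)%R -> 0 < mu (ball x rho).
  move=> Sx rho0; apply: (support_open_gt0 hborel hsupp Sx).
    exact: open_mball.
  exact: (ball_center _ (PosNum rho0)).
have ball_fine x rho : (fine (mu (ball x rho)))%:E = mu (ball x rho).
  by rewrite fineK// fin_num_measure.
split=> [E1|[C C0 h]].
  have [kappa kappa0 h3] :=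
    measure_triple_ball_le hborel hdoubling hr_gt0 hr_cvg hab.
  (* With blocks of mass [m = mu B / (2 * kappa)], the factor [m^-1] is [2 * kappa / mu B], and
     [kappa] does not depend on [B]. *)
  exists (2 * kappa)%R => [|x rho Sx rho0]; first by rewrite mulr_gt0.
  have mux0 := mu_ball_gt0 x rho Sx rho0.
  have b0 : (0 < fine (mu (ball x rho)))%R by rewrite -lte_fin ball_fine.
  have m0 : (0 < fine (mu (ball x rho)) / (2 * kappa))%R.
    by rewrite divr_gt0// mulr_gt0.
  have [phi [phi_lt phiB phi_sum phi_inf]] :=
    block_subsequence mF m0 (fun G => disjoint_block hborel hsupp hr_gt0 hr_cvg
      G E1 kappa0 h3 mux0).
  exists phi; split => //.
  have <- : ((fine (mu (ball x rho)) / (2 * kappa))^-1)%:E =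
      (2 * kappa)%:E / mu (ball x rho).
    by rewrite -ball_fine inver gt_eqF// -EFinM invf_div.
  exact: phi_inf.
set E := lim_sup_set _.
have mE : measurable E.
  by apply: bigcap_measurable => // n _; exact: bigcup_measurable.
pose K n := \bigcap_(j in [set j | (n <= j)%N]) ~` ball (c j) (r j).
have KE n : K n `&` E = set0.
  rewrite -subset0 => y [Kny Ey]; have [j nj jy] := Ey n I.
  exact: (Kny j nj).
have cK n : closed (K n).
  by apply: closed_bigI => j _; rewrite closedC; exact: open_mball.
have EC : ~` E `<=` \bigcup_n K n.
  move=> y nEy; apply: contrapT => nKy; apply: nEy => n _.
  apply: contrapT => njy; apply: nKy; exists n => // j nj jy.
  by apply: njy; exists j.
(* By [kochen_stone] with [K = C / b], the limsup of the subsequence has mass at least [b / C]; it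
   lies in [E] and in the ball. *)
have EM x rho : suppmu x -> (0 < rho)%R ->
    mu (ball x rho) <= C%:E * mu (E `&` ball x rho).
  move=> Sx rho0; have [phi [phi_lt phiB phi_sum phi_inf]] := h x rho Sx rho0.
  set b := fine (mu (ball x rho)).
  have b0 : (0 < b)%R by rewrite -lte_fin ball_fine; exact: mu_ball_gt0.
  have CbE : C%:E / mu (ball x rho) = (C / b)%:E.
    by rewrite -ball_fine inver gt_eqF.
  rewrite CbE in phi_inf.
  have := kochen_stone (fun i => mF (phi i)) (divr_gt0 C0 b0) phi_sum phi_inf.
  rewrite invf_div => bC.
  rewrite -ball_fine -/b -lee_pdivrMl// muleC -EFinM.
  apply: (le_trans bC); apply: le_measure; rewrite ?inE.
  - by apply: bigcap_measurable => // n _; exact: bigcup_measurable.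
  - exact: measurableI.
  have phi_ge n : (n <= phi n)%N.
    elim: n => // n ih; exact: leq_ltn_trans ih (phi_lt n n.+1 _).
  move=> y Ly; split.
    move=> n _; have [j /= nj jy] := Ly n I.
    by exists (phi j) => //=; exact: leq_trans nj (phi_ge j).
  by have [j _ /phiB] := Ly 0%N I.
have K0 n : mu (K n) = 0.
  exact: (closed_null hborel hsupp hdoubling mE (cK n) (KE n) (ltW C0) EM).
have EC0 : mu (~` E) = 0.
  apply/le_anti; rewrite measure_ge0 andbT.
  have mK n : measurable (K n) := measurable_closed hborel (cK n).
  apply: (le_trans (measure_sigma_subadditive mu mK (measurableC mE) EC)).
  by rewrite eseries0 ?lexx// => i _ _; exact: K0.
by rewrite -[E]setCK probability_setC ?EC0 ?sube0//; exact: measurableC.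
Qed.
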